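(* Let $(T_1,T_2)$ be a pure pair of commuting contractions on a Hilbert space $\mathcal{H}$ such that $\|D_{T_1^*}h\|=\|D_{T_2^*}h\|$ for all $h\in\mathcal{H}$. Then $(T_1,T_2)$ dilates to a pair of commuting pure isometries.
   Context: All Hilbert spaces are complex. A contraction $T$ on $\mathcal{H}$ is pure if $\|T^{*m}h\|\to0$ as $m\to\infty$ for every $h\in\mathcal{H}$. A pure pair of commuting contractions is a pair $(T_1,T_2)$ of commuting contractions whose product $T_1T_2$ is a pure contraction (this does not by definition require $T_1$, $T_2$ to be individually pure). A pair of commuting pure isometries is a commuting pair of isometries each of which is pure. For a contraction $T$, $D_{T^*}:=(I-TT^* )^{1/2}$. $(T_1,T_2)$ on $\mathcal{H}$ dilates to a pair $(V_1,V_2)$ on a Hilbert space $\mathcal{K}$ if there is an isometry $\Pi:\mathcal{H}\to\mathcal{K}$ with $\Pi T_i^*=V_i^*\Pi$ for $i=1,2$. *)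

(* Defs.v *)
From HB Require Import structures.
From mathcomp Require Import all_boot all_order all_algebra.
From mathcomp Require Import sesquilinear complex.
From mathcomp Require Import all_classical all_reals all_analysis.

Set Implicit Arguments.
Unset Strict Implicit.
Unset Printing Implicit Defensive.

Import Order.TTheory GRing.Theory Num.Theory.
Import numFieldNormedType.Exports.

Local Open Scope classical_set_scope.
Local Open Scope ring_scope.

(* Complex Hilbert spaces: the scalars are R[i], so the norm `|x| of a vector
   is a nonnegative element of R[i]; the inner product is linear in its first
   argument and conjugate-linear in its second one. *)
HB.mixin Record isHilbert (R : realType) H of CompleteNormedModule R[i] H := {
  inner : {dot H for (@Num.conj R[i])} ;
  sqr_norm_inner : forall x : H, `|x| ^+ 2 = inner x x
}.

#[short(type="hilbertType")]
HB.structure Definition Hilbert (R : realType) :=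
  {H of isHilbert R H & CompleteNormedModule R[i] H}.

Section Operators.
Context {R : realType}.
Implicit Types H K : hilbertType R.

Definition contraction H (T : {linear H -> H}) : Prop :=
  forall h : H, `|T h| <= `|h|.

Definition is_isometry H K (V : {linear H -> K}) : Prop :=
  forall h : H, `|V h| = `|h|.

Definition commuting H (S T : {linear H -> H}) : Prop :=
  forall h : H, S (T h) = T (S h).

(* The adjoint of a bounded operator exists and is unique, so taking it as a
   relation rather than as a function loses nothing. *)
Definition is_adjoint H (T Tstar : {linear H -> H}) : Prop :=
  forall h k : H, inner (T h) k = inner h (Tstar k).

Definition pure H (T : {linear H -> H}) : Prop :=
  exists2 Tstar : {linear H -> H}, is_adjoint T Tstar &
    forall h : H, (fun m : nat => `|iter m Tstar h|) @ \oo --> (0 : R[i]^o).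

(* On R[i], 0 <= z says that z is real and nonnegative. *)
Definition positive_operator H (D : {linear H -> H}) : Prop :=
  forall h : H, 0 <= inner (D h) h.

(* D = (I - T T^* )^{1/2}: for a contraction T this is the unique positive
   square root (an everywhere-defined positive D is automatically bounded). *)
Definition is_defect_adjoint H (T D : {linear H -> H}) : Prop :=
  positive_operator D /\
  exists2 Tstar : {linear H -> H}, is_adjoint T Tstar &
    forall h : H, D (D h) = h - T (Tstar h).

Definition pure_pair_of_commuting_contractions H (T1 T2 : {linear H -> H}) :
    Prop :=
  [/\ contraction T1, contraction T2, commuting T1 T2 & pure (T1 \o T2)].

Definition pair_of_commuting_pure_isometries H (V1 V2 : {linear H -> H}) :
    Prop :=
  [/\ is_isometry V1, is_isometry V2, commuting V1 V2, pure V1 & pure V2].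

Definition dilates_to H K (T1 T2 : {linear H -> H}) (V1 V2 : {linear K -> K}) :
    Prop :=
  exists Pi : {linear H -> K}, is_isometry Pi /\
  exists T1star T2star : {linear H -> H},
  exists V1star V2star : {linear K -> K},
  [/\ is_adjoint T1 T1star, is_adjoint T2 T2star,
      is_adjoint V1 V1star & is_adjoint V2 V2star] /\
  (forall h : H, Pi (T1star h) = V1star (Pi h)) /\
  (forall h : H, Pi (T2star h) = V2star (Pi h)).

End Operators.

(* Main.v *)
(* Write D for the defect operator of T1* .  Equality of the defects says
   |T1* h| = |T2* h|, so |T1*^(2m) h| = |(T1 T2)*^m h| -> 0: T1 is itself pure and
   h |-> (D T1*^n h)_n is an isometry into l^2 that turns T1* into the backward
   shift.  The same equality gives |D T1* h| = |D T2* h|, so D T2* h |-> D T1* h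
   is isometric; after adding infinitely many dimensions to the coefficient space
   it extends to an isometry W of that space.  Then V1 = S (the shift) and
   V2 = S W, with W acting coordinatewise, commute, are pure, and dilate
   (T1, T2). *)
Require Import Defs.
From HB Require Import structures.
From mathcomp Require Import all_boot all_order all_algebra.
From mathcomp Require Import sesquilinear complex.
From mathcomp Require Import all_classical all_reals all_analysis.
From mathcomp Require Import ring lra.

Set Implicit Arguments.
Unset Strict Implicit.
Unset Printing Implicit Defensive.

Import Order.TTheory GRing.Theory Num.Theory.
Import numFieldNormedType.Exports.

Local Open Scope classical_set_scope.
Local Open Scope ring_scope.

(** * Cauchy-Schwarz and triangle inequalities for a bare inner product *)

Section DotForms.
Variables (C : numClosedFieldType) (U : lmodType C).
Variable form : {dot U for (@Num.conj C)}.
Implicit Types u v : U.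

Lemma dotC u v : form u v = (form v u)^*.
Proof. by rewrite hermC mul1r. Qed.

Lemma dot_CauchySchwarz u v : `|form u v| ^+ 2 <= form u u * form v v.
Proof.
have [->|nz_v] := eqVneq v 0.
  by rewrite linear0r normr0 expr0n linear0l mulr0.
have vv_gt0 : 0 < form v v by rewrite dnorm_gt0.
pose a := form u v / form v v; pose w := u - a *: v.
have wv0 : form w v = 0.
  by rewrite linearBl/= linearZl_LR/= divfK ?subrr// gt_eqF.
have uE : u = w + a *: v by rewrite subrK.
have -> : form u u = form w w + `|a| ^+ 2 * form v v.
  by rewrite {1 2}uE hnormDd/= ?dnormZ// linearZr_LR/= wv0 mulr0.
rewrite mulrDl -mulrA -expr2 -[form v v in leRHS](gtr0_norm vv_gt0).
rewrite -exprMn -normrM divfK ?gt_eqF// lerDr.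
by rewrite mulr_ge0// dnorm_ge0.
Qed.

Lemma dot_triangle u v :
  sqrtC (form (u + v) (u + v)) <= sqrtC (form u u) + sqrtC (form v v).
Proof.
rewrite -ler_sqr ?nnegrE ?addr_ge0 ?sqrtC_ge0 ?dnorm_ge0//.
rewrite sqrrD !sqrtCK dnormD [leRHS]addrAC lerD2l.
rewrite -[leRHS]mulr_natr -ler_pdivrMr ?ltr0n//.
apply: (le_trans (y := `|form u v|)).
  have := leif_Re_Creal (form u v).
  by rewrite ReE => /leifP; case: ifP => [_ /eqP->|_ /ltW].
rewrite -ler_sqr ?nnegrE ?mulr_ge0 ?sqrtC_ge0 ?dnorm_ge0//.
by rewrite exprMn !sqrtCK dot_CauchySchwarz.
Qed.

End DotForms.

(** * Squared norms as real numbers *)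

Section HilbertBasics.
Context {R : realType}.
Implicit Types H K : hilbertType R.

(** Norms take values in [R[i]]; this real version makes the total order, [lra] and real limits
    available. *)
Definition nsq H (x : H) : R := complex.Re (inner x x).

Lemma innerxx H (x : H) : inner x x = (nsq x)%:C%C.
Proof. by rewrite /nsq RRe_real// ger0_real// dnorm_ge0. Qed.

Lemma sqr_normE H (x : H) : `|x| ^+ 2 = (nsq x)%:C%C.
Proof. by rewrite sqr_norm_inner innerxx. Qed.

Lemma nsq_ge0 H (x : H) : 0 <= nsq x.
Proof. by rewrite -ler0c -innerxx dnorm_ge0. Qed.

Lemma nsq_eq0 H (x : H) : nsq x = 0 -> x = 0.
Proof. by move=> x0; apply/eqP; rewrite -(dnorm_eq0 (@inner R H)) innerxx x0. Qed.

Lemma nsq0 H : nsq (0 : H) = 0.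
Proof. by rewrite /nsq linear0l. Qed.

Lemma nsqZ H (a : R[i]) (x : H) : nsq (a *: x) = complex.Re (`|a| ^+ 2) * nsq x.
Proof.
rewrite {1}/nsq dnormZ innerxx; have : 0 <= `|a| ^+ 2 by rewrite exprn_ge0.
by case: (`|a| ^+ 2) => b c /ger0_Im/= ->; rewrite mul0r subr0.
Qed.

Lemma nsqN H (x : H) : nsq (- x) = nsq x.
Proof. by rewrite /nsq hnormN. Qed.

Lemma nsqD H (x y : H) : nsq (x + y) = nsq x + nsq y + 2 * complex.Re (inner x y).
Proof.
rewrite /nsq dnormD !raddfD/=; congr (_ + _).
by case: (inner x y) => a b /=; rewrite mulr_natl mulr2n.
Qed.

Lemma nsqB H (x y : H) : nsq (x - y) = nsq x + nsq y - 2 * complex.Re (inner x y).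
Proof. by rewrite nsqD nsqN linearNr raddfN/= mulrN. Qed.

Lemma nsqD_le H (x y : H) : nsq (x + y) <= 2 * nsq x + 2 * nsq y.
Proof. by have := nsq_ge0 (x - y); rewrite nsqB nsqD; lra. Qed.

Lemma nsqi H (x : H) : nsq ('i%C *: x) = nsq x.
Proof. by rewrite nsqZ complexiE normCi expr1n mul1r. Qed.

(** Cruder than Cauchy-Schwarz, but the bound is a sum of squares, hence summable along
    square-summable sequences. *)
Lemma Re_inner_le H (x y : H) : `|complex.Re (inner x y)| <= nsq x + nsq y.
Proof.
rewrite ler_norml; have := nsq_ge0 (x - y); have := nsq_ge0 (x + y).
have := nsq_ge0 x; have := nsq_ge0 y.
by rewrite nsqB nsqD => ? ? ? ?; apply/andP; split; lra.
Qed.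

Lemma Im_innerE H (x y : H) :
  complex.Im (inner x y) = complex.Re (inner x ('i%C *: y)).
Proof.
rewrite linearZr_LR/=; case: (inner x y) => a b /=.
by rewrite !mul0r sub0r mulN1r opprK.
Qed.

Lemma Im_inner_le H (x y : H) : `|complex.Im (inner x y)| <= nsq x + nsq y.
Proof. by rewrite Im_innerE -[X in _ + X]nsqi Re_inner_le. Qed.

Lemma ltr_norm_sqr (V : normedZmodType R[i]) (x : V) (r e : R) :
  `|x| ^+ 2 = r%:C%C -> 0 < e -> (`|x| < e%:C%C) = (r < e ^+ 2).
Proof.
move=> xr e0; rewrite -ltr_sqr ?nnegrE ?normr_ge0 ?ler0c ?ltW//.
by rewrite xr -(rmorphXn (real_complex R)) ltcR.
Qed.

Lemma ltr_norm_nsq H (x : H) (e : R) : 0 < e -> (`|x| < e%:C%C) = (nsq x < e ^+ 2).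
Proof. exact/ltr_norm_sqr/sqr_normE. Qed.

Lemma ler_norm_nsq H K (x : H) (y : K) : (`|x| <= `|y|) = (nsq x <= nsq y).
Proof.
by rewrite -ler_sqr ?nnegrE ?normr_ge0// !sqr_normE lecR.
Qed.

Lemma eq_norm_nsq H K (x : H) (y : K) : (`|x| = `|y|) <-> (nsq x = nsq y).
Proof.
by split => h; apply/eqP; rewrite eq_le -?ler_norm_nsq ?h ?lexx//
   ?ler_norm_nsq ?h ?lexx.
Qed.

Lemma pos_real_complex (e : R[i]) : 0 < e -> exists2 r : R, 0 < r & e = r%:C%C.
Proof.
move=> e0; exists (complex.Re e); last by rewrite RRe_real// gtr0_real.
by rewrite -ltcR RRe_real// gtr0_real.
Qed.

Lemma inner_inj H (x y : H) : (forall z, inner x z = inner y z) -> x = y.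
Proof.
move=> xy; apply/eqP; rewrite -subr_eq0; apply/eqP/nsq_eq0.
by rewrite /nsq linearBl/= xy subrr.
Qed.

End HilbertBasics.

(** * Series of complex numbers *)

Section ComplexSeries.
Context {R : realType}.
Implicit Types (u v : nat -> R[i]) (s t : R[i]) (w : nat -> R).

(** Convergence is split into components so that the comparison test for real series applies. *)
Definition csum_to u s :=
  series (fun n => complex.Re (u n)) @ \oo --> complex.Re s /\
  series (fun n => complex.Im (u n)) @ \oo --> complex.Im s.

Definition csum u : R[i] :=
  (limn (series (fun n => complex.Re (u n))) +i*
   limn (series (fun n => complex.Im (u n))))%C.

Lemma csum_toE u s : csum_to u s -> csum u = s.
Proof.
by case=> us us'; rewrite /csum (cvg_lim _ us)// (cvg_lim _ us')//; case: s us us'.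
Qed.

Lemma is_csum u w M : (forall n, `|complex.Re (u n)| <= w n) ->
  (forall n, `|complex.Im (u n)| <= w n) ->
  (forall n, \sum_(0 <= k < n) w k <= M) -> csum_to u (csum u).
Proof.
move=> uw uw' wM.
have w0 n : 0 <= w n by apply: le_trans (uw n).
have cw : cvgn (series w).
  apply: nondecreasing_is_cvgn; first exact: nondecreasing_series.
  by exists M => _ [n _ <-]; exact: wM.
by split; apply: normed_cvg; apply: (series_le_cvg _ w0 _ cw) => n //=.
Qed.

Lemma csum_toD u v s t : csum_to u s -> csum_to v t ->
  csum_to (fun n => u n + v n) (s + t).
Proof.
move=> [us us'] [vt vt']; split; rewrite raddfD/=.
  under [X in series X]eq_fun do rewrite raddfD/=.
  by rewrite (_ : (fun _ => _) = (fun n => complex.Re (u n)) +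
    (fun n => complex.Re (v n)))// seriesD; apply: cvgD.
under [X in series X]eq_fun do rewrite raddfD/=.
by rewrite (_ : (fun _ => _) = (fun n => complex.Im (u n)) +
    (fun n => complex.Im (v n)))// seriesD; apply: cvgD.
Qed.

Lemma csum_toZ u s a : csum_to u s -> csum_to (fun n => a * u n) (a * s).
Proof.
case: a => a b [us us']; split.
  rewrite (_ : (fun _ => _) = a *: (fun n => complex.Re (u n)) -
    b *: (fun n => complex.Im (u n))); last first.
    by apply/funext => n; rewrite !fctE; case: (u n).
  rewrite seriesD seriesN !seriesZ.
  rewrite (_ : complex.Re _ = a *: complex.Re s - b *: complex.Im s);
    last by case: s {us us'}.
  by apply: cvgB; apply: cvgZl_tmp.
rewrite (_ : (fun _ => _) = a *: (fun n => complex.Im (u n)) +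
    b *: (fun n => complex.Re (u n))); last first.
  by apply/funext => n; rewrite !fctE; case: (u n).
rewrite seriesD !seriesZ.
rewrite (_ : complex.Im _ = a *: complex.Im s + b *: complex.Re s);
  last by case: s {us us'}.
by apply: cvgD; apply: cvgZl_tmp.
Qed.

Lemma csum_to_conj u s : csum_to u s -> csum_to (fun n => (u n)^*) (s^*).
Proof.
case=> us us'; split.
  rewrite (_ : (fun _ => _) = (fun n => complex.Re (u n))).
    by case: s us us'.
  by apply/funext => n; case: (u n).
rewrite (_ : (fun _ => _) = - (fun n => complex.Im (u n))).
  rewrite seriesN (_ : complex.Im _ = - complex.Im s); first exact: cvgN.
  by case: s us us'.
by apply/funext => n; rewrite !fctE; case: (u n).
Qed.

Lemma series_cvg_recl w (l : R) : series (fun n => w n.+1) @ \oo --> l ->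
  series w @ \oo --> w 0%N + l.
Proof.
move=> wl; rewrite -cvg_shiftS.
rewrite (_ : (fun _ => _) = (fun=> w 0%N) + series (fun n => w n.+1)).
  by apply: cvgD => //; exact: cvg_cst.
by apply/funext => n; rewrite !fctE /series/= big_nat_recl.
Qed.

Lemma csum_to_recl u s : csum_to (fun n => u n.+1) s -> csum_to u (u 0%N + s).
Proof.
case=> us us'; split; rewrite raddfD/=.
  exact: (series_cvg_recl (w := fun n => complex.Re (u n))).
exact: (series_cvg_recl (w := fun n => complex.Im (u n))).
Qed.

End ComplexSeries.

(** * The vector space of square-summable sequences *)

Section SquareSummable.
Context {R : realType} (H : hilbertType R).
Implicit Types x y : nat -> H.

Definition sqsum x := exists M, forall n, \sum_(0 <= k < n) nsq (x k) <= M.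

Lemma sqsum0 : sqsum (fun=> 0).
Proof. by exists 0 => n; rewrite big1// => i _; rewrite nsq0. Qed.

Lemma sqsumD x y : sqsum x -> sqsum y -> sqsum (fun n => x n + y n).
Proof.
move=> [M xM] [N yN]; exists (2 * M + 2 * N) => n.
apply: (@le_trans _ _ (2 * \sum_(0 <= k < n) nsq (x k) +
                       2 * \sum_(0 <= k < n) nsq (y k))).
  by rewrite !mulr_sumr -big_split ler_sum// => i _; exact: nsqD_le.
by have := xM n; have := yN n; lra.
Qed.

Lemma sqsumZ a x : sqsum x -> sqsum (fun n => a *: x n).
Proof.
move=> [M xM]; exists (complex.Re (`|a| ^+ 2) * M) => n.
under eq_bigr do rewrite nsqZ.
rewrite -mulr_sumr ler_wpM2l//.
have : 0 <= `|a| ^+ 2 by rewrite exprn_ge0.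
by rewrite lecE => /andP[].
Qed.

Lemma sqsum_recl x : sqsum (fun n => x n.+1) <-> sqsum x.
Proof.
split=> -[M xM].
  exists (nsq (x 0%N) + M) => -[|n]; last by rewrite big_nat_recl ?lerD2l.
  by rewrite big_geq ?addr_ge0 ?nsq_ge0// (le_trans _ (xM 0%N))// big_geq.
exists M => n; have := xM n.+1; rewrite big_nat_recl//.
by have := nsq_ge0 (x 0%N); lra.
Qed.

Lemma csum_to_inner x y : sqsum x -> sqsum y ->
  csum_to (fun n => inner (x n) (y n)) (csum (fun n => inner (x n) (y n))).
Proof.
move=> [M xM] [N yN].
apply: (is_csum (w := fun n => nsq (x n) + nsq (y n)) (M := M + N)) => n.
- exact: Re_inner_le.
- exact: Im_inner_le.
- by rewrite big_split lerD.
Qed.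

Record ell2 := Ell2 { ell2_val :> nat -> H ; _ : `[< sqsum ell2_val >] }.

HB.instance Definition _ := [isSub for ell2_val].
HB.instance Definition _ := [Choice of ell2 by <:].

Definition sqsum_pred : {pred (nat -> H)} := fun x => `[< sqsum x >].

Lemma sqsum_submod_closed : submod_closed sqsum_pred.
Proof.
split=> [|a x y /asboolP xs /asboolP ys]; apply/asboolP; first exact: sqsum0.
exact: sqsumD (sqsumZ a xs) ys.
Qed.

HB.instance Definition _ :=
  GRing.isSubmodClosed.Build R[i] (nat -> H) sqsum_pred sqsum_submod_closed.
HB.instance Definition _ :=
  GRing.SubChoice_isSubLmodule.Build R[i] (nat -> H) sqsum_pred ell2
  sqsum_submod_closed.

End SquareSummable.

(** * Inner product and norm on square-summable sequences *)

Section Ell2Inner.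
Context {R : realType} (H : hilbertType R).
Implicit Types x y z : ell2 H.

Lemma ell2P x : sqsum x.
Proof. by apply/asboolP; case: x. Qed.

Lemma ell2_inj x y : x =1 y -> x = y.
Proof. by move=> xy; apply/val_inj/funext. Qed.

Lemma ell2D x y n : (x + y) n = x n + y n. Proof. by []. Qed.
Lemma ell2N x n : (- x) n = - x n. Proof. by []. Qed.
Lemma ell2Z a x n : (a *: x) n = a *: x n. Proof. by []. Qed.

Definition ell2_inner x y : R[i] := csum (fun n => inner (x n) (y n)).

Lemma ell2_innerP x y : csum_to (fun n => inner (x n) (y n)) (ell2_inner x y).
Proof. exact: csum_to_inner (ell2P x) (ell2P y). Qed.

Lemma ell2_innerC x y : ell2_inner x y = (ell2_inner y x)^*.
Proof.
apply: csum_toE.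
rewrite (_ : (fun _ => _) = (fun n => (inner (y n) (x n))^*)).
  exact/csum_to_conj/ell2_innerP.
by apply/funext => n; rewrite dotC.
Qed.

Lemma ell2_inner_linearl z : GRing.linear_for *%R (ell2_inner ^~ z).
Proof.
move=> a x y /=; apply: csum_toE.
under [X in csum_to X]eq_fun do rewrite linearPl/=.
by apply: csum_toD; [apply: csum_toZ|]; exact: ell2_innerP.
Qed.

Lemma ell2_inner_linearr z :
  GRing.linear_for (@Num.conj R[i] \; *%R) (ell2_inner z).
Proof.
move=> a x y; rewrite ell2_innerC ell2_inner_linearl/= rmorphD rmorphM/=.
by rewrite -!ell2_innerC.
Qed.

HB.instance Definition _ := bilinear_isBilinear.Build R[i] (ell2 H) (ell2 H)
  R[i] *%R (@Num.conj R[i] \; *%R) ell2_inner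
  (ell2_inner_linearl, ell2_inner_linearr).

Lemma ell2_inner_hermitian x y :
  ell2_inner x y = (-1) ^+ false * (ell2_inner y x)^*.
Proof. by rewrite mul1r ell2_innerC. Qed.

HB.instance Definition _ := isHermitianSesquilinear.Build R[i] (ell2 H) false
  (@Num.conj R[i]) ell2_inner ell2_inner_hermitian.

(** Stands in for [nsq] until [ell2 H] is known to be a Hilbert space; [ell2_nsqE] then identifies
    the two. *)
Definition ell2_nsq x : R := limn (series (fun n => nsq (x n))).

Lemma ell2_innerxx x : ell2_inner x x = (ell2_nsq x)%:C%C.
Proof.
rewrite /ell2_inner/= /csum/=; congr Complex.
rewrite (_ : (fun _ => _) = fun=> 0).
  rewrite (_ : series _ = fun=> 0); first by rewrite lim_cst.
  by apply/funext => n; rewrite /series/= big1.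
by apply/funext => n; rewrite innerxx.
Qed.

Lemma cvg_ell2_nsq x : series (fun n => nsq (x n)) @ \oo --> ell2_nsq x.
Proof.
by have [] := ell2_innerP x x; rewrite ell2_innerxx.
Qed.

Lemma nondecreasing_nsq x : nondecreasing_seq (series (fun n => nsq (x n))).
Proof. by apply: nondecreasing_series => n _ _; exact: nsq_ge0. Qed.

Lemma ell2_nsq_ge x n : \sum_(0 <= k < n) nsq (x k) <= ell2_nsq x.
Proof.
apply: (nondecreasing_cvgn_le (@nondecreasing_nsq x)) n.
by apply/cvg_ex; eexists; exact: cvg_ell2_nsq.
Qed.

Lemma ell2_nsq_le x M : (forall n, \sum_(0 <= k < n) nsq (x k) <= M) ->
  ell2_nsq x <= M.
Proof.
move=> xM; apply: limr_le; last by near=> n; exact: xM.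
by apply/cvg_ex; eexists; exact: cvg_ell2_nsq.
Unshelve. all: by end_near. Qed.

Lemma nsq_le_ell2 x n : nsq (x n) <= ell2_nsq x.
Proof.
apply: le_trans (ell2_nsq_ge x n.+1); rewrite big_nat_recr//= lerDr.
by rewrite sumr_ge0// => i _; exact: nsq_ge0.
Qed.

Lemma ell2_inner_gt0 x : x != 0 -> 0 < ell2_inner x x.
Proof.
move=> x0; rewrite ell2_innerxx ltcR lt_neqAle; apply/andP; split; last first.
  by have := ell2_nsq_ge x 0; rewrite big_geq.
apply: contra x0 => /eqP x0; apply/eqP/ell2_inj => n; apply/nsq_eq0/eqP.
by rewrite eq_le nsq_ge0 andbT x0 nsq_le_ell2.
Qed.

HB.instance Definition _ :=
  isDotProduct.Build R[i] (ell2 H) ell2_inner ell2_inner_gt0.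

Definition ell2_norm x : R[i] := sqrtC (ell2_inner x x).

Lemma ell2_normD x y : ell2_norm (x + y) <= ell2_norm x + ell2_norm y.
Proof. exact: dot_triangle. Qed.

Lemma ell2_normZ a x : ell2_norm (a *: x) = `|a| * ell2_norm x.
Proof.
rewrite /ell2_norm dnormZ sqrtCM ?nnegrE ?exprn_ge0 ?dnorm_ge0//.
by rewrite sqrCK.
Qed.

Lemma ell2_norm0_eq0 x : ell2_norm x = 0 -> x = 0.
Proof. by move/eqP; rewrite sqrt_dnorm_eq0 => /eqP. Qed.

HB.instance Definition _ := Lmodule_isNormed.Build R[i] (ell2 H)
  ell2_normD ell2_normZ ell2_norm0_eq0.

Lemma ell2_sqr_norm x : `|x| ^+ 2 = ell2_inner x x.
Proof. by rewrite sqrtCK. Qed.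

Lemma ell2_ltr_norm x (e : R) : 0 < e -> (`|x| < e%:C%C) = (ell2_nsq x < e ^+ 2).
Proof. by move=> e0; apply: ltr_norm_sqr; rewrite // ell2_sqr_norm ell2_innerxx. Qed.

Lemma ell2_ballE x (e : R) y : 0 < e ->
  ball x e%:C%C y = (ell2_nsq (x - y) < e ^+ 2) :> Prop.
Proof. by move=> e0; rewrite -ball_normE /ball_/= ell2_ltr_norm. Qed.

End Ell2Inner.

(** * Completeness of the sequence space *)

Section Ell2Complete.
Context {R : realType} (H : hilbertType R).
Implicit Types x y z : ell2 H.

Lemma ell2_nsqD_le x y : ell2_nsq (x + y) <= 2 * ell2_nsq x + 2 * ell2_nsq y.
Proof.
apply: ell2_nsq_le => n.
apply: (@le_trans _ _ (2 * \sum_(0 <= k < n) nsq (x k) +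
                       2 * \sum_(0 <= k < n) nsq (y k))).
  by rewrite !mulr_sumr -big_split ler_sum// => i _; exact: nsqD_le.
by have := ell2_nsq_ge x n; have := ell2_nsq_ge y n; lra.
Qed.

(** By [nsq_le_ell2] coordinates do not increase distances, so the image filter is Cauchy in the
    complete space [H]. *)
Lemma ell2_coord_cvg (F : set_system (ell2 H)) k : ProperFilter F ->
  cauchy F -> exists l : H, (fun x : ell2 H => x k) @ F --> l.
Proof.
move=> FF /cauchyP FC.
suff /cauchy_cvg/cvg_ex : cauchy ((fun x : ell2 H => x k) @ F) by [].
apply: cauchy_exP => e /[dup] e0 /FC[x Fx]; exists (x k).
have [r r0 er] := pos_real_complex e0.
suff xk : ball x e `<=` (fun y : ell2 H => ball (x k) e (y k)).
  by apply: filterS xk Fx.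
move=> y; rewrite er ell2_ballE// => xy.
rewrite -ball_normE /ball_/= ltr_norm_nsq//.
exact: le_lt_trans (nsq_le_ell2 (x - y) k) xy.
Qed.

(** The limit is formed coordinate by coordinate. Estimates on the first [n] coordinates, uniform in
    [n], then give both its square summability and the convergence in norm. *)
Lemma ell2_complete (F : set_system (ell2 H)) :
  ProperFilter F -> cauchy F -> cvg F.
Proof.
move=> FF FC.
have [l Fl] := choice (fun k => ell2_coord_cvg k FF FC).
have near_sum n (d : R) : 0 < d ->
    F [set y : ell2 H | \sum_(0 <= k < n) nsq (l k - y k) < d].
  elim: n d => [|n IHn] d d0.
    by apply: filterS filterT => y _ /=; rewrite big_geq.
  have d20 : 0 < d / 2 by rewrite divr_gt0.
  have sd0 : 0 < Num.sqrt (d / 2) by rewrite sqrtr_gt0.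
  have /cvgrPdist_lt/(_ (Num.sqrt (d / 2))%:C%C) := Fl n.
  rewrite ltcR => /(_ sd0); apply: filterS2 (IHn _ d20) => y /= yn.
  rewrite ltr_norm_nsq// sqr_sqrtr ?ltW// => ynn.
  by rewrite big_nat_recr//= [d]splitr ltrD.
(* The comparison point [y] depends on [n], the bound does not: [y] is within [e] of [x] and close
   to [l] on [n] coordinates, and [nsqD_le] gives the constant 2 + 2. *)
have close (e : R) x : 0 < e -> F (ball x e%:C%C) ->
    forall n, \sum_(0 <= k < n) nsq (l k - x k) <= 4 * e ^+ 2.
  move=> e0 Fx n; have e20 : 0 < e ^+ 2 by rewrite exprn_gt0.
  have [y [yn]] := filter_ex (filterI (near_sum n _ e20) Fx).
  move=> /=; rewrite ell2_ballE// => xy.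
  apply: (@le_trans _ _ (2 * \sum_(0 <= k < n) nsq (l k - y k) +
                         2 * \sum_(0 <= k < n) nsq ((x - y) k))).
    rewrite !mulr_sumr -big_split ler_sum// => i _.
    rewrite -(nsqN ((x - y) i)).
    have -> : l i - x i = (l i - y i) + - (x - y) i.
      by rewrite ell2D ell2N opprB addrA subrK.
    exact: nsqD_le.
  by have := ell2_nsq_ge (x - y) n; have := yn : (_ < _); lra.
have /cauchyP FCx := FC.
have ls : sqsum l.
  have [|x Fx] := FCx 1; first by [].
  have -> : l = (fun n => (l n - x n) + x n) by apply/funext => n; rewrite subrK.
  apply: sqsumD; last exact: ell2P.
  by exists (4 * 1 ^+ 2) => n; apply: (close 1).
pose L := Ell2 (asboolT ls).
apply/cvg_ex; exists L; apply/cvg_ballP => e /pos_real_complex[r r0 ->].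
(* With radius [r / 4] the squared distance from [L] to [y] is below 2 (r^2 / 4) + 2 (r^2 / 16),
   which is less than r^2. *)
have r40 : 0 < r / 4 by rewrite divr_gt0.
have [|x Fx] := FCx (r / 4)%:C%C; first by rewrite ltcR.
have Lx := ell2_nsq_le (x := L - x) (close _ _ r40 Fx).
apply: filterS Fx => y; rewrite !ell2_ballE// => xy.
have -> : L - y = (L - x) + (x - y) by rewrite addrA subrK.
apply: le_lt_trans (ell2_nsqD_le _ _) _.
by have := exprn_gt0 2 r0; move: Lx xy; rewrite exprMn exprVn; lra.
Qed.

HB.instance Definition _ := Uniform_isComplete.Build (ell2 H) ell2_complete.

HB.instance Definition _ := isHilbert.Build R (ell2 H) (@ell2_sqr_norm R H).

End Ell2Complete.

(** * The shift and the backward shift *)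

Section Ell2Shift.
Context {R : realType} (H : hilbertType R).
Implicit Types x y : ell2 H.

Lemma ell2_nsqE x : nsq x = ell2_nsq x.
Proof. exact: (congr1 (@complex.Re R) (ell2_innerxx x)). Qed.

Lemma ell2_tailP x : sqsum (fun n => x n.+1).
Proof. exact/sqsum_recl/ell2P. Qed.

Definition ell2_tail x : ell2 H := Ell2 (asboolT (ell2_tailP x)).

Lemma ell2_consP (a : H) x : sqsum (fun n => if n is m.+1 then x m else a).
Proof. exact/sqsum_recl/ell2P. Qed.

(** For [a = 0] this is the unilateral shift; other values of [a] serve to build vectors by hand. *)
Definition ell2_cons a x : ell2 H := Ell2 (asboolT (ell2_consP a x)).

Lemma ell2_tailK a x : ell2_tail (ell2_cons a x) = x.
Proof. exact: ell2_inj. Qed.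

Lemma ell2_inner_recl x y :
  inner x y = inner (x 0%N) (y 0%N) + inner (ell2_tail x) (ell2_tail y).
Proof.
apply: csum_toE; apply: (csum_to_recl (u := fun n => inner (x n) (y n))).
exact: (ell2_innerP (ell2_tail x) (ell2_tail y)).
Qed.

Lemma nsq_recl x : nsq x = nsq (x 0%N) + nsq (ell2_tail x).
Proof. by rewrite /nsq ell2_inner_recl raddfD. Qed.

Lemma iter_ell2_tail m x n : iter m ell2_tail x n = x (m + n)%N.
Proof. by elim: m n => //= m IHm n; rewrite IHm addnS. Qed.

Lemma nsq_iter_tail m x :
  nsq (iter m ell2_tail x) = nsq x - \sum_(0 <= k < m) nsq (x k).
Proof.
elim: m => [|m IHm]; first by rewrite big_geq// subr0.
rewrite big_nat_recr//= opprD addrA -IHm (nsq_recl (iter m _ _)).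
by rewrite iter_ell2_tail addn0 addrAC subrr add0r.
Qed.

(** Purity of the shift: these numbers are the remainders of the convergent series for [nsq x]. *)
Lemma cvg_nsq_iter_tail x : (fun m => nsq (iter m ell2_tail x)) @ \oo --> (0 : R).
Proof.
under eq_fun do rewrite nsq_iter_tail.
have := cvgB (cvg_cst (ell2_nsq x)) (@cvg_ell2_nsq _ _ x).
by rewrite subrr -ell2_nsqE; exact.
Qed.

End Ell2Shift.

(** * Operators acting coordinatewise *)

Section Ell2Map.
Context {R : realType} (H : hilbertType R) (T : {linear H -> H}).
Hypothesis T_le : forall h : H, nsq (T h) <= nsq h.

Lemma ell2_mapP (x : ell2 H) : sqsum (fun n => T (x n)).
Proof.
have [M xM] := ell2P x; exists M => n; apply: le_trans (xM n).
by rewrite ler_sum.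
Qed.

Definition ell2_map x : ell2 H := Ell2 (asboolT (ell2_mapP x)).

Lemma ell2_map_tail x : ell2_map (ell2_tail x) = ell2_tail (ell2_map x).
Proof. exact: ell2_inj. Qed.

Lemma ell2_map_cons0 x : ell2_map (ell2_cons 0 x) = ell2_cons 0 (ell2_map x).
Proof. by apply: ell2_inj => -[|n] //=; rewrite linear0. Qed.

Lemma nsq_ell2_map : (forall h, nsq (T h) = nsq h) ->
  forall x, nsq (ell2_map x) = nsq x.
Proof.
move=> Tiso x; rewrite !ell2_nsqE /ell2_nsq/=.
by congr (limn (series _)); apply/funext => n; exact: Tiso.
Qed.

End Ell2Map.

(** * Adjoints, polarization and symmetry of positive operators *)

Section Adjoints.
Context {R : realType}.
Implicit Types H K : hilbertType R.

(** Stated for plain functions: having an adjoint forces linearity, so operators can be written as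
    functions first and packed by [adjoint_pair_pack]. *)
Definition adjoint_pair H K (f : H -> K) (g : K -> H) :=
  forall h k, inner (f h) k = inner h (g k).

Lemma adjoint_pairC H K (f : H -> K) (g : K -> H) :
  adjoint_pair f g -> adjoint_pair g f.
Proof. by move=> fg k h; rewrite dotC -fg -dotC. Qed.

Lemma adjoint_pair_linear H K (f : H -> K) (g : K -> H) :
  adjoint_pair f g -> linear f.
Proof. by move=> fg a x y; apply: inner_inj => k; rewrite linearPl/= !fg linearPl. Qed.

Lemma adjoint_pair_pack H K (f : H -> K) (g : K -> H) : adjoint_pair f g ->
  exists (F : {linear H -> K}) (G : {linear K -> H}), F =1 f /\ G =1 g.
Proof.
move=> fg.
pose F : {linear H -> K} := HB.pack f
  (GRing.isLinear.Build _ _ _ _ f (adjoint_pair_linear fg)).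
pose G : {linear K -> H} := HB.pack g
  (GRing.isLinear.Build _ _ _ _ g (adjoint_pair_linear (adjoint_pairC fg))).
by exists F, G.
Qed.

Lemma adjoint_pair_unique H K (f : H -> K) (g g' : K -> H) :
  adjoint_pair f g -> adjoint_pair f g' -> g =1 g'.
Proof.
move=> fg fg' k; apply: inner_inj => h.
by rewrite (adjoint_pairC fg) (adjoint_pairC fg').
Qed.

(** Polarization: [h + k] gives the real parts, and replacing [k] by ['i *: k] the imaginary
    parts. *)
Lemma nsq_isometry_inner (U : lmodType R[i]) H (A B : {linear U -> H}) :
  (forall h, nsq (A h) = nsq (B h)) ->
  forall h k, inner (A h) (A k) = inner (B h) (B k).
Proof.
move=> AB.
have ReAB h k : complex.Re (inner (A h) (A k)) = complex.Re (inner (B h) (B k)).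
  have := AB (h + k); rewrite !linearD !nsqD !AB => /addrI.
  by apply: mulfI; rewrite pnatr_eq0.
move=> h k; apply/eqP; rewrite eq_complex ReAB eqxx/=.
by rewrite !Im_innerE -!linearZ ReAB.
Qed.

(** Over complex scalars a real quadratic form comes from a symmetric operator: evaluation at
    [h + k] makes the imaginary parts antisymmetric, and replacing [h] by ['i *: h] turns this into
    equality of the real parts. *)
Lemma positive_operator_symmetric H (D : {linear H -> H}) :
  positive_operator D -> adjoint_pair D D.
Proof.
move=> D0.
have DI h : complex.Im (inner (D h) h) = 0 by exact/ger0_Im/D0.
have ImD h k : complex.Im (inner (D h) k) = - complex.Im (inner (D k) h).
  apply/eqP; rewrite -addr_eq0; apply/eqP.
  have := DI (h + k); rewrite linearD !linearDl !linearDr/= !raddfD/= !DI.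
  by rewrite add0r addr0.
move=> h k; rewrite [RHS]dotC; apply/eqP; rewrite eq_complex.
have <- : complex.Re (inner (D k) h) = complex.Re ((inner (D k) h)^*).
  by case: (inner (D k) h).
have <- : - complex.Im (inner (D k) h) = complex.Im ((inner (D k) h)^*).
  by case: (inner (D k) h).
rewrite (ImD k h) opprK eqxx andbT; apply/eqP.
have ReE (z : R[i]) : complex.Re z = complex.Im ('i%C * z).
  by case: z => a b /=; rewrite mul0r mul1r add0r.
rewrite ReE.
have -> : 'i%C * inner (D h) k = inner (D ('i%C *: h)) k.
  by rewrite linearZ linearZl_LR.
rewrite ImD linearZr_LR/=; case: (inner (D k) h) => a b /=.
by rewrite mul0r mulN1r add0r opprK.
Qed.

End Adjoints.

(** * Closed ranges and minimizing sequences *)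

Section IsometryBetweenRanges.
Context {R : realType} (U : lmodType R[i]) (H : hilbertType R).
Implicit Types A B : {linear U -> H}.

Lemma inner_le (x y : H) : `|inner x y| <= `|x| * `|y|.
Proof.
rewrite -ler_sqr ?nnegrE ?mulr_ge0// exprMn !sqr_norm_inner.
exact: dot_CauchySchwarz.
Qed.

Lemma cvg_innerl (x : nat -> H) (l y : H) : x @ \oo --> l ->
  (fun n => inner (x n) y : R[i]^o) @ \oo --> (inner l y : R[i]^o).
Proof.
move=> xl; apply/cvgrPdist_lt => e e0.
have y0 : 0 < `|y| + 1 by rewrite ltr_wpDl.
have /cvgrPdist_lt/(_ (e / (`|y| + 1))) := xl.
rewrite divr_gt0// => /(_ isT); apply: filterS => n.
rewrite ltr_pdivlMr// => xn; rewrite -linearBl/=.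
apply: le_lt_trans (inner_le _ _) (le_lt_trans _ xn).
by rewrite ler_wpM2l// lerDl.
Qed.

Lemma inner_lim_eq (x x' : nat -> H) (l l' y y' : H) :
  x @ \oo --> l -> x' @ \oo --> l' ->
  (forall n, inner (x n) y = inner (x' n) y') -> inner l y = inner l' y'.
Proof.
move=> /(cvg_innerl (y := y)) xl /(cvg_innerl (y := y')) xl' xx'.
move: xl; under eq_fun do rewrite xx'.
by move=> xl; apply: (cvg_unique _ xl xl').
Qed.

Lemma nsq_cauchy_cvg (x : nat -> H) :
  (forall n m, nsq (x n - x m) <= 2 * n.+1%:R^-1 + 2 * m.+1%:R^-1) ->
  exists l : H, x @ \oo --> l.
Proof.
move=> xc; suff /cauchy_cvg/cvg_ex : cauchy (x @ \oo) by [].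
apply: cauchy_exP => e /pos_real_complex[r r0 ->].
have r20 : 0 < r ^+ 2 / 4 by rewrite divr_gt0// exprn_gt0.
have [N _ NE] := near_infty_natSinv_lt (PosNum r20).
exists (x N); exists N => // n /= Nn.
rewrite -ball_normE /ball_/= ltr_norm_nsq//; apply: le_lt_trans (xc _ _) _.
have n4 : n.+1%:R^-1 < r ^+ 2 / 4 := NE n Nn.
have N4 : N.+1%:R^-1 < r ^+ 2 / 4 := NE N (leqnn N).
rewrite -mulrDr (_ : r ^+ 2 = 2 * (r ^+ 2 / 4 + r ^+ 2 / 4)); last by field.
by rewrite ltr_pM2l// ltrD.
Qed.

(** When [A h] and [B h] always have equal norms, this relation is the graph of the isometry from
    the closed range of [A] onto that of [B] extending [A h] to [B h]. *)
Definition range_closure A B (u v : H) := exists a : nat -> U,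
  (fun n => A (a n)) @ \oo --> u /\ (fun n => B (a n)) @ \oo --> v.

Lemma range_closureC A B u v : range_closure A B u v -> range_closure B A v u.
Proof. by move=> [a [? ?]]; exists a. Qed.

Lemma range_closure_img A B h : range_closure A B (A h) (B h).
Proof. by exists (fun=> h); split; exact: cvg_cst. Qed.

Lemma range_closure_orth A B u v z : range_closure A B u v ->
  (forall h, inner z (A h) = 0) -> inner z u = 0.
Proof.
move=> [a [au _]] zA; rewrite dotC.
rewrite (inner_lim_eq (y := z) (y' := z) au (cvg_cst (0 : H))).
  by rewrite linear0l conjC0.
by move=> n; rewrite linear0l dotC zA conjC0.
Qed.

(** The polarized identity passes to the limit in one argument at a time; [dotC] brings the other
    argument to the front. *)
Lemma range_closure_isometry A B u v u' v' : (forall h, nsq (A h) = nsq (B h)) ->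
  range_closure A B u v -> range_closure A B u' v' -> inner u u' = inner v v'.
Proof.
move=> AB [a [au bv]] [a' [au' bv']].
apply: (inner_lim_eq au bv) => n; rewrite dotC [RHS]dotC; congr (_^*).
apply: (inner_lim_eq au' bv') => m; exact: nsq_isometry_inner.
Qed.

Lemma minimizing_sequence A (f : H) : exists a : nat -> U,
  forall n h, nsq (f - A (a n)) <= nsq (f - A h) + n.+1%:R^-1.
Proof.
pose E := [set nsq (f - A h) | h in setT].
have Einf : has_inf E.
  by split; [exists (nsq (f - A 0)), 0|exists 0 => _ [h _ <-]; exact: nsq_ge0].
suff /choice[a aP] : forall n : nat, exists a : U,
    forall h, nsq (f - A a) <= nsq (f - A h) + n.+1%:R^-1 by exists a.
move=> n; have n0 : 0 < n.+1%:R^-1 :> R by rewrite invr_gt0 ltr0n.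
have [_ [a _ <-] aE] := inf_adherent n0 Einf.
exists a => h; apply: le_trans (ltW aE) _; rewrite lerD2r.
by apply: ge_inf; [case: Einf|exists h].
Qed.

Lemma minimizing_cauchy A f (a : nat -> U) :
  (forall n h, nsq (f - A (a n)) <= nsq (f - A h) + n.+1%:R^-1) ->
  forall n m, nsq (A (a n) - A (a m)) <= 2 * n.+1%:R^-1 + 2 * m.+1%:R^-1.
Proof.
(* The parallelogram law at the midpoint, whose image cannot be much closer to [f] than [A (a n)]
   and [A (a m)] are. *)
move=> aP n m; pose h := 2^-1 *: (a n + a m).
have hE : f - A (a n) + (f - A (a m)) = 2 *: (f - A h).
  rewrite [A h]linearZ [A (_ + _)]linearD scalerBr scalerA divff ?pnatr_eq0// scale1r.
  by rewrite scaler_nat mulr2n opprD addrACA.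
have dE : f - A (a n) - (f - A (a m)) = - (A (a n) - A (a m)).
  by rewrite !opprB addrC addrA subrK.
have Re4 : complex.Re (`|2 : R[i]| ^+ 2) = 4 by rewrite normr_nat -natrX raddfMn.
have := nsqD (f - A (a n)) (f - A (a m)).
have := nsqB (f - A (a n)) (f - A (a m)).
rewrite dE nsqN hE nsqZ Re4; have := aP n h; have := aP m h.
set p := n.+1%:R^-1; set q := m.+1%:R^-1.
lra.
Qed.

End IsometryBetweenRanges.

(** * Orthogonal projection and partial isometry between closed ranges *)

Section RangeProjection.
Context {R : realType} (U : lmodType R[i]) (H : hilbertType R).
Implicit Types A B : {linear U -> H}.

Lemma nsqZ_real (t : R) (x : H) : nsq (t%:C%C *: x) = t ^+ 2 * nsq x.
Proof. by rewrite nsqZ -add_Re2_Im2/= expr0n addr0. Qed.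

(* Optimise [nsq (f - A (a n + t h))] over real [t]. *)
Lemma minimizing_Re_orth A f (a : nat -> U) :
  (forall n h, nsq (f - A (a n)) <= nsq (f - A h) + n.+1%:R^-1) ->
  forall n h, complex.Re (inner (f - A (a n)) (A h)) ^+ 2 <=
              (nsq (A h) + 1) * n.+1%:R^-1.
Proof.
move=> aP n h; set r := f - A (a n); set c := complex.Re _.
have N0 := nsq_ge0 (A h); set N := nsq (A h) in N0 *.
have N1 : 0 < N + 1 by rewrite ltr_wpDl.
(* The exact optimum is [c / N]; the added 1 covers [A h = 0] and costs only the constant in the
   bound. *)
pose t := c / (N + 1).
have := aP n (a n + t%:C%C *: h).
have -> : A (a n + t%:C%C *: h) = A (a n) + t%:C%C *: A h.
  by rewrite linearD linearZ.
rewrite opprD addrA -/r; clearbody r; rewrite nsqB nsqZ_real -/N.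
have -> : complex.Re (inner r (t%:C%C *: A h)) = t * c.
  rewrite linearZr_LR/= /c; case: (inner r (A h)) => x y /=.
  by rewrite oppr0 mul0r subr0.
have cE : c = t * (N + 1) by rewrite divfK ?gt_eqF.
clearbody t; rewrite cE; set p := n.+1%:R^-1 => tp.
have tN : t ^+ 2 * (N + 1) <= p.
  by have := sqr_ge0 t; lra.
by rewrite exprMn [(N + 1) ^+ 2]expr2 mulrA [leRHS]mulrC ler_pM2r.
Qed.

Lemma minimizing_sqr_inner_le A f (a : nat -> U) :
  (forall n h, nsq (f - A (a n)) <= nsq (f - A h) + n.+1%:R^-1) ->
  forall n h, `|inner (f - A (a n)) (A h)| ^+ 2 <=
              (2 * (nsq (A h) + 1) * n.+1%:R^-1)%:C%C.
Proof.
move=> aP n h; rewrite -add_Re2_Im2 lecR Im_innerE -linearZ/=.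
have := minimizing_Re_orth aP n h; have := minimizing_Re_orth aP n ('i%C *: h).
have -> : nsq (A ('i%C *: h)) = nsq (A h) by rewrite linearZ nsqi.
by rewrite -mulrA mulr_natl mulr2n => ? ?; exact: lerD.
Qed.

(** Here [u] is the orthogonal projection of [f] onto the closed range of [A]. The images under [B]
    of the same minimizing sequence are Cauchy too, and their limit is the partner [v]. *)
Lemma range_closure_proj A B (f : H) : (forall h, nsq (A h) = nsq (B h)) ->
  exists u v, range_closure A B u v /\ forall h, inner (f - u) (A h) = 0.
Proof.
move=> AB; have [a aP] := minimizing_sequence A f.
have Aa := minimizing_cauchy aP.
have [u au] := nsq_cauchy_cvg Aa.
have [|v bv] := @nsq_cauchy_cvg R H (fun n => B (a n)).
  by move=> n m; rewrite -linearB -AB linearB.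
exists u, v; split=> [|h]; first by exists a.
have ru : (fun n => f - A (a n)) @ \oo --> f - u.
  by apply: cvgB au; exact: cvg_cst.
suff r0 : (fun n => inner (f - A (a n)) (A h) : R[i]^o) @ \oo --> (0 : R[i]^o).
  exact: (cvg_unique _ (cvg_innerl (y := A h) ru) r0).
apply/cvgrPdist_lt => e /pos_real_complex[r r0 ->].
have N1 : 0 < nsq (A h) + 1 by rewrite ltr_wpDl// nsq_ge0.
have d0 : 0 < r ^+ 2 / (2 * (nsq (A h) + 1)).
  by rewrite divr_gt0// ?exprn_gt0// mulr_gt0.
have := near_infty_natSinv_lt (PosNum d0); apply: filterS => n /= nd.
rewrite sub0r normrN -ltr_sqr ?nnegrE// ?ler0c ?ltW//.
apply: le_lt_trans (minimizing_sqr_inner_le aP n h) _.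
rewrite -(rmorphXn (real_complex R)) ltcR.
by rewrite mulrC -ltr_pdivlMr// mulr_gt0.
Qed.

(* [C] is the partial isometry from the closed range of [A] to that of [B] and
   [Q] the orthogonal projection onto the complement of the former. *)
Lemma partial_isometry_between_ranges A B : (forall h, nsq (A h) = nsq (B h)) ->
  exists C C' Q : {linear H -> H},
  [/\ adjoint_pair C C', adjoint_pair Q Q,
      forall f, nsq (C f) + nsq (Q f) = nsq f & forall h, C' (B h) = A h].
Proof.
move=> AB.
have BA h : nsq (B h) = nsq (A h) by [].
(* [P] projects onto the closed range of [A] and [C f] is the partner of [P f]; [P'] and [C'] do the
   same with [A] and [B] exchanged. *)
have [P /choice[C PC]] := choice (fun f => range_closure_proj f AB).
have [P' /choice[C' PC']] := choice (fun f => range_closure_proj f BA).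
have rC f : range_closure A B (P f) (C f) := (PC f).1.
have rC' g : range_closure A B (C' g) (P' g) := range_closureC (PC' g).1.
have orthP f u v : range_closure A B u v -> inner f u = inner (P f) u.
  move=> uv; apply/eqP; rewrite -subr_eq0 -linearBl/=.
  by rewrite (range_closure_orth uv)//; exact: (PC f).2.
have orthP' g u v : range_closure A B u v -> inner g v = inner (P' g) v.
  move=> /range_closureC uv; apply/eqP; rewrite -subr_eq0 -linearBl/=.
  by rewrite (range_closure_orth uv)//; exact: (PC' g).2.
have isoAB := range_closure_isometry AB.
have adjC : adjoint_pair C C'.
  move=> f g; rewrite dotC (orthP' _ _ _ (rC f)) -dotC.
  by rewrite -(isoAB _ _ _ _ (rC f) (rC' g)) -(orthP _ _ _ (rC' g)).
pose Q f := f - P f.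
have adjQ : adjoint_pair Q Q.
  move=> f g; rewrite /Q linearBl linearBr/=; congr (_ - _).
  by rewrite dotC (orthP _ _ _ (rC f)) -dotC (orthP _ _ _ (rC g)).
have [C1 [C1' [CE CE']]] := adjoint_pair_pack adjC.
have [Q1 [_ [QE _]]] := adjoint_pair_pack adjQ.
exists C1, C1', Q1; split.
- by move=> f g; rewrite CE CE'.
- by move=> f g; rewrite !QE.
- move=> f; rewrite CE QE.
  have -> : nsq (C f) = nsq (P f) by rewrite /nsq (isoAB _ _ _ _ (rC f) (rC f)).
  have -> : nsq (Q f) = nsq f - nsq (P f); last by rewrite addrC subrK.
  by rewrite nsqB (orthP _ _ _ (rC f)) -/(nsq _); lra.
- move=> h; rewrite CE'.
  have r1 := rC' (B h); have r2 := range_closure_img A B h.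
  (* The difference lies in the closed range of [B] and is orthogonal to it. *)
  have P'B : P' (B h) = B h.
    apply/eqP; rewrite eq_sym -subr_eq0; apply/eqP/nsq_eq0; rewrite /nsq.
    by rewrite linearBr/= (PC' _).2 (range_closure_orth (PC' _).1 (PC' _).2) subrr.
  rewrite P'B in r1.
  (* [C' (B h)] and [A h] have the same partner [B h], so the isometry makes all inner products
     between them equal and their difference has norm 0. *)
  apply/eqP; rewrite -subr_eq0; apply/eqP/nsq_eq0; rewrite /nsq.
  rewrite linearBl !linearBr/=.
  by rewrite (isoAB _ _ _ _ r1 r1) (isoAB _ _ _ _ r1 r2) (isoAB _ _ _ _ r2 r1)
    (isoAB _ _ _ _ r2 r2) !subrr.
Qed.

End RangeProjection.

(** * Adjoints on the sequence space and extension to an isometry *)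

Section Ell2Operators.
Context {R : realType} (H : hilbertType R).
Implicit Types x y : ell2 H.

Lemma ell2_inner_cons a x y :
  inner (ell2_cons a x) y = inner a (y 0%N) + inner x (ell2_tail y).
Proof. by rewrite ell2_inner_recl ell2_tailK. Qed.

Lemma nsq_ell2_cons a x : nsq (ell2_cons a x) = nsq a + nsq x.
Proof. by rewrite nsq_recl ell2_tailK. Qed.

Lemma adjoint_shift : adjoint_pair (@ell2_cons R H 0) (@ell2_tail R H).
Proof. by move=> x y; rewrite ell2_inner_cons linear0l add0r. Qed.

(** The nonnegative number [nsq (k - V (V' k))] expands to [nsq k - nsq (V' k)]. *)
Lemma adjoint_isometry_le (K : hilbertType R) (V : H -> K) (V' : K -> H) :
  adjoint_pair V V' ->
  (forall h, nsq (V h) = nsq h) -> forall k : K, nsq (V' k) <= nsq k.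
Proof.
move=> VV' Viso k; have := nsq_ge0 (k - V (V' k)).
rewrite nsqB Viso dotC VV' innerxx/=; lra.
Qed.

Lemma adjoint_ell2_map (T T' : {linear H -> H}) hT hT' : adjoint_pair T T' ->
  adjoint_pair (@ell2_map R H T hT) (@ell2_map R H T' hT').
Proof.
move=> TT' x y; apply: csum_toE; have := ell2_innerP x (ell2_map hT' y).
rewrite (_ : (fun _ => _) = (fun n => inner (ell2_map hT x n) (y n)))//.
by apply/funext => n; rewrite TT'.
Qed.

(** What [C] loses of coordinate 0 is kept by [Q] in a newly inserted coordinate 1, and the old tail
    moves one place right. The last clause concerns vectors supported in coordinate 0, the only kind
    that the embedding of [H] produces. *)
Lemma isometric_extension (C C' Q : {linear H -> H}) :
  adjoint_pair C C' -> adjoint_pair Q Q ->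
  (forall f, nsq (C f) + nsq (Q f) = nsq f) ->
  exists W W' : {linear ell2 H -> ell2 H},
  [/\ adjoint_pair W W', forall x, nsq (W x) = nsq x &
      forall a, W' (ell2_cons a 0) = ell2_cons (C' a) 0].
Proof.
move=> CC' QQ CQ.
pose w x := ell2_cons (C (x 0%N)) (ell2_cons (Q (x 0%N)) (ell2_tail x)).
pose w' y := ell2_cons (C' (y 0%N) + Q (y 1%N)) (ell2_tail (ell2_tail y)).
have ww' : adjoint_pair w w'.
  move=> x y; rewrite !ell2_inner_cons (ell2_inner_recl x) ell2_tailK linearDr.
  by rewrite CC' QQ addrA.
have [W [W' [WE WE']]] := adjoint_pair_pack ww'.
exists W, W'; split.
- by move=> x y; rewrite WE WE'.
- by move=> x; rewrite WE !nsq_ell2_cons addrA CQ -nsq_recl.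
- move=> a; rewrite WE'; apply: ell2_inj => -[|n] //=.
  by rewrite linear0 addr0.
Qed.

End Ell2Operators.

(** * Purity in terms of squared norms *)

Section Purity.
Context {R : realType}.
Implicit Types H : hilbertType R.

Lemma cvg_norm_nsq H (x : nat -> H) :
  (fun n => `|x n|) @ \oo --> (0 : R[i]^o) <-> (fun n => nsq (x n)) @ \oo --> (0 : R).
Proof.
split=> /cvgrPdist_lt x0; apply/cvgrPdist_lt => e e0.
  have se0 : 0 < Num.sqrt e by rewrite sqrtr_gt0.
  have := x0 (Num.sqrt e)%:C%C; rewrite ltcR => /(_ se0); apply: filterS => n.
  rewrite sub0r normrN normr_id ltr_norm_nsq// sqr_sqrtr ?ltW// sub0r normrN.
  by rewrite ger0_norm// nsq_ge0.
have [r r0 ->] := pos_real_complex e0.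
have := x0 (r ^+ 2); rewrite exprn_gt0// => /(_ isT); apply: filterS => n.
by rewrite !sub0r !normrN normr_id ltr_norm_nsq// ger0_norm// nsq_ge0.
Qed.

(** Adjoints are unique, so the one hidden in [pure] may be replaced by any given one. *)
Lemma pureP H (T T' : {linear H -> H}) : adjoint_pair T T' ->
  pure T <-> forall h, (fun m => nsq (iter m T' h)) @ \oo --> (0 : R).
Proof.
move=> TT'; split=> [[T'' TT'' pT] h|pT].
  apply/cvg_norm_nsq.
  under eq_fun do rewrite (eq_iter (adjoint_pair_unique TT' TT'')).
  exact: pT.
by exists T' => // h; apply/cvg_norm_nsq.
Qed.

Lemma iter_linear (V : lmodType R[i]) (T : {linear V -> V}) n : linear (iter n T).
Proof. by move=> a x y; elim: n => //= n ->; rewrite linearP. Qed.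

End Purity.

(** * The commuting pure isometries [s] and [s \o w] *)

Section CommutingPureIsometries.
Context {R : realType} (K : hilbertType R) (s s' w w' : K -> K).
Hypotheses (ss' : adjoint_pair s s') (ww' : adjoint_pair w w').
Hypotheses (s_iso : forall x, nsq (s x) = nsq x) (w_iso : forall x, nsq (w x) = nsq x).
Hypotheses (sw : forall x, s (w x) = w (s x)) (s'w' : forall x, s' (w' x) = w' (s' x)).
Hypothesis s'0 : forall x, (fun m => nsq (iter m s' x)) @ \oo --> (0 : R).

(** The factors [w'] move past the [s'] to the outside, where they can only shorten, [w'] being the
    adjoint of an isometry. *)
Lemma nsq_iter_comp_le m x : nsq (iter m (w' \o s') x) <= nsq (iter m s' x).
Proof.
elim: m x => // m IHm x; rewrite !iterSr/=; apply: le_trans (IHm _) _.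
have -> : iter m s' (w' (s' x)) = w' (iter m s' (s' x)).
  by elim: m {IHm} => //= m ->; rewrite s'w'.
exact: adjoint_isometry_le ww' w_iso _.
Qed.

Lemma commuting_pure_isometries : exists V1 V2 V1' V2' : {linear K -> K},
  [/\ pair_of_commuting_pure_isometries V1 V2, is_adjoint V1 V1',
      is_adjoint V2 V2', V1' =1 s' & V2' =1 w' \o s'].
Proof.
have [V1 [V1' [V1E V1E']]] := adjoint_pair_pack ss'.
have adj2 : adjoint_pair (s \o w) (w' \o s') by move=> x y; rewrite /= ss' ww'.
have [V2 [V2' [V2E V2E']]] := adjoint_pair_pack adj2.
have adjV1 : is_adjoint V1 V1' by move=> x y; rewrite V1E V1E' ss'.
have adjV2 : is_adjoint V2 V2' by move=> x y; rewrite V2E V2E' adj2.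
exists V1, V2, V1', V2'; split=> //; split.
- by move=> h; apply/eq_norm_nsq; rewrite V1E s_iso.
- by move=> h; apply/eq_norm_nsq; rewrite V2E/= s_iso w_iso.
- by move=> h; rewrite !V1E !V2E /= sw.
- apply/(pureP adjV1) => h; under eq_fun do rewrite (eq_iter V1E').
  exact: s'0.
- apply/(pureP adjV2) => h; under eq_fun do rewrite (eq_iter V2E').
  apply: squeeze_cvgr (cvg_cst 0) (s'0 h).
  by apply: nearW => m; rewrite nsq_ge0 nsq_iter_comp_le.
Qed.

End CommutingPureIsometries.

(** * Embedding of [H] by its defect sequence *)

Section DefectEmbedding.
Context {R : realType} (H : hilbertType R) (T' D : {linear H -> H}).
Hypothesis DE : forall h, nsq (D h) = nsq h - nsq (T' h).

Lemma sum_nsq_defect h n :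
  \sum_(0 <= k < n) nsq (D (iter k T' h)) = nsq h - nsq (iter n T' h).
Proof.
elim: n => [|n IHn]; first by rewrite big_geq// subrr.
by rewrite big_nat_recr//= IHn DE addrA subrK.
Qed.

(** Coefficients sit in coordinate 0 of [ell2 H]; the remaining coordinates are the spare dimensions
    used by [isometric_extension]. *)
Let Pi_seq h n : ell2 H := ell2_cons (D (iter n T' h)) 0.

Let nsq_Pi_seq h k : nsq (Pi_seq h k) = nsq (D (iter k T' h)).
Proof. by rewrite nsq_ell2_cons nsq0 addr0. Qed.

Let Pi_seqP h : sqsum (Pi_seq h).
Proof.
exists (nsq h) => n; under eq_bigr do rewrite nsq_Pi_seq.
by rewrite sum_nsq_defect gerBl nsq_ge0.
Qed.

(** The squared norms telescope by [sum_nsq_defect], and the remainder [nsq (iter n T' h)] tends to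
    0, so the embedding preserves norms. *)
Lemma defect_embedding :
  (forall h, (fun m => nsq (iter m T' h)) @ \oo --> (0 : R)) ->
  exists2 Pi : {linear H -> ell2 (ell2 H)}, is_isometry Pi &
    forall h n, Pi h n = ell2_cons (D (iter n T' h)) 0.
Proof.
move=> T'0; pose p h : ell2 (ell2 H) := Ell2 (asboolT (Pi_seqP h)).
have plin : linear p.
  move=> a x y; apply: ell2_inj => n; rewrite ell2D ell2Z /= /Pi_seq.
  rewrite iter_linear linearP; apply: ell2_inj => -[|m] //.
  by rewrite [RHS](_ : _ = a *: 0 + 0 :> H)// scaler0 addr0.
pose P : {linear H -> ell2 (ell2 H)} := HB.pack p
  (GRing.isLinear.Build _ _ _ _ p plin).
exists P => // h; apply/eq_norm_nsq; rewrite ell2_nsqE.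
apply: cvg_lim => //; rewrite (_ : series _ = fun n => nsq h - nsq (iter n T' h)).
  by rewrite -[X in _ --> X]subr0; apply: cvgB; [exact: cvg_cst|exact: T'0].
apply/funext => n; rewrite -sum_nsq_defect /series/=.
by apply: eq_bigr => k _; rewrite nsq_Pi_seq.
Qed.

End DefectEmbedding.

(** * Consequences of equal defects *)

Section EqualDefects.
Context {R : realType} (H : hilbertType R).
Implicit Types T D : {linear H -> H}.

(** A positive [D] is symmetric, so [nsq (D h)] is the real part of [inner (D (D h)) h]. *)
Lemma nsq_defect T T' D : adjoint_pair T T' -> positive_operator D ->
  (forall h, D (D h) = h - T (T' h)) ->
  forall h, nsq (D h) = nsq h - nsq (T' h).
Proof.
move=> TT' /positive_operator_symmetric DD DE h.
by rewrite /nsq -DD DE linearBl/= TT' raddfB.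
Qed.

(** Both compositions are adjoint to [T1 \o T2]. *)
Lemma adjoint_commuting T1 T2 T1' T2' : commuting T1 T2 ->
  adjoint_pair T1 T1' -> adjoint_pair T2 T2' -> forall h, T1' (T2' h) = T2' (T1' h).
Proof.
move=> T12 a1 a2; apply: (@adjoint_pair_unique _ _ _ (T1 \o T2)) => h k /=.
  by rewrite T12 a2 a1.
by rewrite a1 a2.
Qed.

Variables T1' T2' : {linear H -> H}.
Hypothesis comm' : forall h, T1' (T2' h) = T2' (T1' h).
Hypothesis nsq12 : forall h, nsq (T1' h) = nsq (T2' h).

Lemma iter_comm (n : nat) h : iter n T1' (T2' h) = T2' (iter n T1' h).
Proof. by elim: n => //= n ->; rewrite comm'. Qed.

(* By commutation and [nsq12], the length of a product of [T1'] and [T2']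
   applied to [h] depends only on the number of factors. *)
Lemma nsq_iter_double m h :
  nsq (iter m.*2 T1' h) = nsq (iter m (T2' \o T1') h).
Proof.
elim: m h => // m IHm h; rewrite doubleS !iterSr IHm/=.
have comm k : iter m (T2' \o T1') (T1' k) = T1' (iter m (T2' \o T1') k).
  by elim: m {IHm} => //= m ->; rewrite comm'.
have comm2 k : iter m (T2' \o T1') (T2' k) = T2' (iter m (T2' \o T1') k).
  by elim: m {IHm comm} => //= m ->; rewrite comm'.
by rewrite !comm comm2 comm nsq12.
Qed.

Lemma cvg_nsq_iter_of_product : (forall h, nsq (T1' h) <= nsq h) ->
  (forall h, (fun m => nsq (iter m (T2' \o T1') h)) @ \oo --> (0 : R)) ->
  forall h, (fun m => nsq (iter m T1' h)) @ \oo --> (0 : R).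
Proof.
move=> T1_le T0 h; apply/cvgrPdist_lt => e e0.
have /cvgrPdist_lt/(_ e e0)[N _ NE] := T0 h.
(* The product controls only even powers of [T1']; the [n - N.*2] further factors are
   contractions. *)
exists N.*2 => // n /= /subnK <-.
have := NE N (leqnn N); rewrite /= !sub0r !normrN !ger0_norm ?nsq_ge0//.
rewrite -nsq_iter_double; apply: le_lt_trans.
by elim: (n - N.*2)%N => // k; apply: le_trans (T1_le _).
Qed.

End EqualDefects.

Theorem theorem5p4 (R : realType) (H : hilbertType R)
    (T1 T2 D1 D2 : {linear H -> H}) :
  pure_pair_of_commuting_contractions T1 T2 ->
  is_defect_adjoint T1 D1 -> is_defect_adjoint T2 D2 ->
  (forall h : H, `|D1 h| = `|D2 h|) ->
  exists (K : hilbertType R) (V1 V2 : {linear K -> K}),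
    pair_of_commuting_pure_isometries V1 V2 /\ dilates_to T1 T2 V1 V2.
Proof.
move=> [_ _ T12 pT] [D1_pos [T1' adj1 D1E]] [D2_pos [T2' adj2 D2E]] D12.
have D1N := nsq_defect adj1 D1_pos D1E.
have D2N := nsq_defect adj2 D2_pos D2E.
have comm' := adjoint_commuting T12 adj1 adj2.
have nsq12 h : nsq (T1' h) = nsq (T2' h).
  by have /eq_norm_nsq := D12 h; rewrite D1N D2N => /addrI/oppr_inj.
have T1'_le h : nsq (T1' h) <= nsq h by rewrite -subr_ge0 -D1N nsq_ge0.
have T1'0 : forall h, (fun m => nsq (iter m T1' h)) @ \oo --> (0 : R).
  apply: (cvg_nsq_iter_of_product comm' nsq12 T1'_le).
  have adj12 : adjoint_pair (T1 \o T2) (T2' \o T1').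
    by move=> h k /=; rewrite adj1 adj2.
  exact/(pureP adj12).
have [Pi Pi_iso PiE] := defect_embedding D1N T1'0.
(* The order of the two operators matters: the adjoint [C'] must send [D1 (T1' h)] to [D1 (T2' h)],
   since [V2'] is to act as [T2'] on the image of [Pi]. *)
have [|C [C' [Q [CC' QQ CQ C'E]]]] :=
    @partial_isometry_between_ranges R H H (D1 \o T2') (D1 \o T1').
  (* The two defects agree since [T1' h] and [T2' h] have equal norms, as do [T1' (T2' h)] and
     [T1' (T1' h)]. *)
  by move=> h /=; rewrite !D1N -nsq12 comm' (nsq12 (T1' h)).
have [W [W' [WW' W_iso W'E]]] := isometric_extension CC' QQ CQ.
have W_le x : nsq (W x) <= nsq x by rewrite W_iso.
have W'_le := adjoint_isometry_le WW' W_iso.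
have [|V1 [V2 [V1' [V2' [V12 adjV1 adjV2 V1E V2E]]]]] :=
  commuting_pure_isometries (@adjoint_shift R (ell2 H))
    (adjoint_ell2_map W_le W'_le WW') _ (nsq_ell2_map W_le W_iso)
    (fun x => esym (ell2_map_cons0 W_le x)) (fun x => esym (ell2_map_tail W'_le x))
    (@cvg_nsq_iter_tail R (ell2 H)).
  by move=> x; rewrite nsq_ell2_cons nsq0 add0r.
exists _, V1, V2; split=> //; exists Pi; split=> //.
exists T1', T2', V1', V2'; split=> //; split=> h; apply: ell2_inj => n.
  by rewrite V1E PiE -iterSr /= PiE.
(* The backward shift supplies an extra [T1'] in coordinate [n], and [C'] exchanges it for [T2']. *)
rewrite V2E PiE /= PiE W'E; congr ell2_cons.
by rewrite iter_comm//; exact: esym (C'E _).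
Qed.
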